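(* Let $d\ge 1$ be a fixed integer and let $\varepsilon>0$ and $C>0$ be fixed. Let $q$ be a power of an odd prime, let $E\subseteq \mathbb F_q^d$, and let $\alpha=(\alpha_1,\alpha_2,\alpha_3)\in\mathbb F_q^3$. Suppose that at least one of the following holds: (i) $|E|\ge C q^{\varepsilon}\, q^{\frac{d+3}{2}}$; (ii) at least one of $\alpha_1,\alpha_2,\alpha_3$ is nonzero and $|E|\ge C q^{\varepsilon}\, q^{\frac{d+2}{2}}$; (iii) all of $\alpha_1,\alpha_2,\alpha_3$ are nonzero and $|E|\ge C q^{\varepsilon}\, q^{\frac{d+1}{2}}$. Then $$|\Pi_\alpha(E)|=(1+o(1))\frac{|E|^4}{q^3},$$ where $o(1)$ denotes a quantity tending to $0$ as $q\to\infty$ (with $d,\varepsilon,C$ fixed), uniformly over all such $E$ and $\alpha$.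
   Context: $\mathbb F_q$ is the finite field with $q$ elements, and $x\cdot y=\sum_{i=1}^d x_iy_i\in\mathbb F_q$ for $x,y\in\mathbb F_q^d$. For a sequence $\alpha=(\alpha_1,\dots,\alpha_k)$ of elements of $\mathbb F_q$, a dot product $k$-chain (of type $\alpha$) is a $(k+1)$-tuple of distinct points $(x_1,\dots,x_{k+1})$ with $x_j\cdot x_{j+1}=\alpha_j$ for every $1\le j\le k$. For $E\subseteq\mathbb F_q^d$, $\Pi_\alpha(E)$ is the set of dot product $k$-chains of type $\alpha$ all of whose points lie in $E$; here $k=3$. *)

(* Defs.v *)
From HB Require Import structures.
From mathcomp Require Import all_boot all_order all_algebra.
Set Implicit Arguments.
Unset Strict Implicit.
Unset Printing Implicit Defensive.
Import GRing.Theory.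
Local Open Scope ring_scope.

Definition odd_prime_power (q : nat) : Prop :=
  exists p n : nat, [/\ prime p, odd p, (0 < n)%N & q = (p ^ n)%N].

Definition dotp (F : finFieldType) (d : nat) (x y : 'rV[F]_d) : F :=
  \sum_(i < d) x 0 i * y 0 i.

(* Indices start at 0: [lift ord0 j] is the successor of [j] in ['I_k.+1]. *)
Definition dot_chain (F : finFieldType) (d k : nat) (alpha : k.-tuple F)
    (x : k.+1.-tuple 'rV[F]_d) : bool :=
  uniq x &&
  [forall j : 'I_k,
     dotp (tnth x (widen_ord (leqnSn k) j)) (tnth x (lift ord0 j))
     == tnth alpha j].

Definition dot_chains_in (F : finFieldType) (d k : nat) (alpha : k.-tuple F)
    (E : {set 'rV[F]_d}) : {set k.+1.-tuple 'rV[F]_d} :=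
  [set x : k.+1.-tuple 'rV[F]_d |
     dot_chain alpha x && [forall i, tnth x i \in E]].

(* Main.v *)
Require Import Defs.
From HB Require Import structures.
From mathcomp Require Import all_boot all_order all_algebra.
From mathcomp Require Import all_classical all_reals all_analysis.
From mathcomp Require Import ring lra.
Set Implicit Arguments.
Unset Strict Implicit.
Unset Printing Implicit Defensive.
Import Order.TTheory GRing.Theory Num.Theory.
Import numFieldNormedType.Exports.
Local Open Scope classical_set_scope.
Local Open Scope ring_scope.

(** Write the incidence matrix [x . y = a] as the constant matrix 1/q plus a
    remainder B.  The entries of B^2 count common solutions of two linear
    equations, hence vanish off parallel pairs, and Schur's test gives
    |B|^2 <= q^d in general and |B|^2 <= 2 q^(d-1) when a != 0.  Starting from
    the indicator of E, each application of the incidence matrix restricted to E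
    keeps a vector of the form c (1_E + e), multiplies c by |E|/q and 1 + |e| by
    at most 1 + t, where t = |B| q / |E| (norms relative to |1_E|).  So the
    walks of length k in E number |E|^(k+1) / q^k up to a factor 1 + O(t).  A
    3-walk whose points are not distinct is determined by a 2-walk and by which
    two points coincide, so such walks are a fraction O(q / |E|) = O(t) of all.
    Each of the three hypotheses forces t = O(q^-eps). *)

(** * Bilinearity and nondegeneracy of the dot product *)

Lemma dotpC (F : finFieldType) (d : nat) (x y : 'rV[F]_d) : dotp x y = dotp y x.
Proof. by apply: eq_bigr => i _; rewrite mulrC. Qed.

Lemma dotpDr (F : finFieldType) (d : nat) (x y z : 'rV[F]_d) :
  dotp x (y + z) = dotp x y + dotp x z.
Proof. by rewrite -big_split; apply: eq_bigr => i _; rewrite mxE mulrDr. Qed.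

Lemma dotpZr (F : finFieldType) (d : nat) (c : F) (x y : 'rV[F]_d) :
  dotp x (c *: y) = c * dotp x y.
Proof. by rewrite mulr_sumr; apply: eq_bigr => i _; rewrite mxE mulrCA. Qed.

Lemma dotpDl (F : finFieldType) (d : nat) (x y z : 'rV[F]_d) :
  dotp (x + y) z = dotp x z + dotp y z.
Proof. by rewrite dotpC dotpDr !(dotpC z). Qed.

Lemma dotpZl (F : finFieldType) (d : nat) (c : F) (x y : 'rV[F]_d) :
  dotp (c *: x) y = c * dotp x y.
Proof. by rewrite dotpC dotpZr dotpC. Qed.

Lemma dotp0l (F : finFieldType) (d : nat) (y : 'rV[F]_d) : dotp 0 y = 0.
Proof. by rewrite -(scale0r 0) dotpZl mul0r. Qed.

Lemma dotp_delta (F : finFieldType) (d : nat) (x : 'rV[F]_d) i :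
  dotp x (delta_mx 0 i) = x 0 i.
Proof.
rewrite /dotp (bigD1 i) //= big1 ?addr0 => [|j /negPf ji]; rewrite mxE eqxx.
  by rewrite eqxx mulr1.
by rewrite ji mulr0.
Qed.

Lemma dotp_eq1 (F : finFieldType) (d : nat) (x : 'rV[F]_d) :
  x != 0 -> exists v, dotp x v = 1.
Proof.
case/rV0Pn => i xi; exists ((x 0 i)^-1 *: delta_mx 0 i).
by rewrite dotpZr dotp_delta mulVf.
Qed.

(** With x . u = 1, the vector z - (z . u) x is nonzero, so some w pairs to 1 with it; correcting w
    by a multiple of u makes it orthogonal to x. *)
Lemma dotp_eq01 (F : finFieldType) (d : nat) (x z : 'rV[F]_d) :
  x != 0 -> (forall c, z != c *: x) ->
  exists v, dotp x v = 0 /\ dotp z v = 1.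
Proof.
move=> x0 zx; have [u xu] := dotp_eq1 x0.
have [|w zw] := @dotp_eq1 _ _ (z - dotp z u *: x).
  by rewrite subr_eq0.
exists (w - dotp x w *: u); split.
  by rewrite -scaleNr dotpDr dotpZr xu mulr1 subrr.
move: zw; rewrite -!scaleNr dotpDl dotpDr !dotpZl dotpZr.
by rewrite !mulNr mulrC.
Qed.

(** Translation by multiples of v preserves f and permutes the level sets of [dotp z], so all q
    level sets carry the same share of the sum. *)
Lemma equidistribution (R : realFieldType) (F : finFieldType) (d : nat)
    (f : 'rV[F]_d -> R) (z v : 'rV[F]_d) (b : F) :
    dotp z v = 1 -> (forall y c, f (y + c *: v) = f y) ->
  #|F|%:R * \sum_y f y * (dotp z y == b)%:R = \sum_y f y.
Proof.
move=> zv fv; have -> : \sum_y f y = \sum_c \sum_y f y * (dotp z y == c)%:R.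
  rewrite exchange_big; apply: eq_bigr => y _.
  rewrite (bigD1 (dotp z y)) //= eqxx mulr1 big1 ?addr0 // => c.
  by rewrite eq_sym => /negPf ->; rewrite mulr0.
have fibre c : \sum_y f y * (dotp z y == c)%:R
             = \sum_y f y * (dotp z y == b)%:R.
  rewrite (reindex_inj (addIr ((c - b) *: v))); apply: eq_bigr => y _.
  rewrite fv dotpDr dotpZr zv mulr1 addrCA -{2}[c]addr0.
  by rewrite (inj_eq (addrI c)) subr_eq0.
by under [RHS]eq_bigr do rewrite fibre; rewrite sumr_const mulr_natl.
Qed.

(** * The remainder matrix B and the entries of its square *)

Definition disc (R : realFieldType) (F : finFieldType) (d : nat) (a : F)
    (x y : 'rV[F]_d) : R :=
  (dotp x y == a)%:R - #|F|%:R^-1.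

(** Entries of B^2, since B ([disc]) is symmetric. *)
Definition corr (R : realFieldType) (F : finFieldType) (d : nat) (a : F)
    (x z : 'rV[F]_d) : R :=
  \sum_y disc R a x y * disc R a z y.

Lemma discC (R : realFieldType) (F : finFieldType) (d : nat) (a : F)
    (x y : 'rV[F]_d) : disc R a x y = disc R a y x.
Proof. by rewrite /disc dotpC. Qed.

Lemma corrC (R : realFieldType) (F : finFieldType) (d : nat) (a : F)
    (x y : 'rV[F]_d) : corr R a x y = corr R a y x.
Proof. by apply: eq_bigr => z _; rewrite mulrC. Qed.

Lemma card_field_gt0 (R : realFieldType) (F : finFieldType) : (0 : R) < #|F|%:R.
Proof. by rewrite ltr0n; apply/card_gt0P; exists 0. Qed.

Lemma card_field_ge1 (R : realFieldType) (F : finFieldType) : (1 : R) <= #|F|%:R.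
Proof. by rewrite ler1n; apply/card_gt0P; exists 0. Qed.

Lemma card_space (R : realFieldType) (F : finFieldType) (d : nat) :
  #|{: 'rV[F]_d}|%:R = #|F|%:R ^+ d :> R.
Proof. by rewrite card_mx mul1n natrX. Qed.

Lemma sum_dotp_eq (R : realFieldType) (F : finFieldType) (d : nat) (a : F)
    (x : 'rV[F]_d) : x != 0 ->
  \sum_y (dotp x y == a)%:R = #|F|%:R ^+ d / #|F|%:R :> R.
Proof.
have q0 := card_field_gt0 R F.
case/dotp_eq1 => v xv; have := @equidistribution R F d (fun=> 1) x v a xv.
move/(_ (fun _ _ => erefl)); rewrite sumr_const card_space => <-.
rewrite mulrAC mulfV ?gt_eqF // mul1r.
by apply: eq_bigr => y _; rewrite mul1r.
Qed.

Lemma sum_dotp_eq2 (R : realFieldType) (F : finFieldType) (d : nat) (a : F)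
    (x z : 'rV[F]_d) : x != 0 -> (forall c, z != c *: x) ->
  \sum_y (dotp x y == a)%:R * (dotp z y == a)%:R
    = #|F|%:R ^+ d / #|F|%:R / #|F|%:R :> R.
Proof.
have q0 := card_field_gt0 R F.
move=> x0 zx; have [v [xv zv]] := dotp_eq01 x0 zx.
have := @equidistribution R F d (fun y => (dotp x y == a)%:R) z v a zv.
rewrite sum_dotp_eq // => <-; first by rewrite mulrAC mulfV ?gt_eqF // mul1r.
by move=> y c; rewrite dotpDr dotpZr xv mulr0 addr0.
Qed.

Lemma sum_disc (R : realFieldType) (F : finFieldType) (d : nat) (a : F)
    (x : 'rV[F]_d) : x != 0 -> \sum_y disc R a x y = 0.
Proof.
move=> x0; rewrite big_split /= sum_dotp_eq // sumr_const.
by rewrite mulNrn -[_^-1 *+ _]mulr_natl card_space subrr.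
Qed.

(** The row of B at a nonzero z sums to 0, so the constant 1/q in the other factor contributes
    nothing. *)
Lemma corrE (R : realFieldType) (F : finFieldType) (d : nat) (a : F)
    (x z : 'rV[F]_d) : z != 0 ->
  corr R a x z = \sum_y (dotp x y == a)%:R * disc R a z y.
Proof.
move=> z0; rewrite /corr.
under eq_bigr do rewrite [disc R a x _]/disc mulrBl.
by rewrite big_split /= sumrN -mulr_sumr sum_disc // mulr0 subr0.
Qed.

Lemma corrE2 (R : realFieldType) (F : finFieldType) (d : nat) (a : F)
    (x z : 'rV[F]_d) : x != 0 -> z != 0 ->
  corr R a x z = \sum_y (dotp x y == a)%:R * (dotp z y == a)%:R
                 - #|F|%:R ^+ d / #|F|%:R / #|F|%:R.
Proof.
move=> x0 z0; rewrite corrE // /disc.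
under eq_bigr do rewrite mulrBr.
by rewrite big_split /= sumrN -mulr_suml sum_dotp_eq.
Qed.

Lemma corr_indep (R : realFieldType) (F : finFieldType) (d : nat) (a : F)
    (x z : 'rV[F]_d) : x != 0 -> (forall c, z != c *: x) -> corr R a x z = 0.
Proof.
move=> x0 zx; have z0 : z != 0 by have := zx 0; rewrite scale0r.
by rewrite corrE2 // sum_dotp_eq2 // subrr.
Qed.

Lemma corr0l (R : realFieldType) (F : finFieldType) (d : nat) (a : F)
    (z : 'rV[F]_d) : z != 0 -> corr R a 0 z = 0.
Proof.
move=> z0; rewrite corrE //.
under eq_bigr do rewrite dotp0l.
by rewrite -mulr_sumr sum_disc // mulr0.
Qed.

Lemma corr00 (R : realFieldType) (F : finFieldType) (d : nat) (a : F) :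
  corr R a (0 : 'rV[F]_d) 0 = #|F|%:R ^+ d * ((0 == a)%:R - #|F|%:R^-1) ^+ 2.
Proof.
rewrite /corr /disc; under eq_bigr do rewrite dotp0l -expr2.
by rewrite sumr_const -[_ ^+ 2 *+ _]mulr_natl card_space.
Qed.

(** By [corrE] the sum runs only over the hyperplane z . y = a, which has q^(d-1) points when z is
    nonzero, and each entry of B is at most 1 in absolute value. *)
Lemma norm_corr_le (R : realFieldType) (F : finFieldType) (d : nat) (a : F)
    (x z : 'rV[F]_d) : x != 0 ->
  `|corr R a x z| <= #|F|%:R ^+ d / #|F|%:R.
Proof.
have q0 := card_field_gt0 R F; have q1 := card_field_ge1 R F.
have V1 : 0 <= (#|F|%:R^-1 : R) <= 1 by rewrite invr_ge0 ltW //= invf_le1.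
move=> x0; rewrite corrC corrE //.
have [->|z0] := eqVneq z 0.
  under eq_bigr do rewrite dotp0l.
  rewrite -mulr_sumr sum_disc // mulr0 normr0.
  by rewrite divr_ge0 ?exprn_ge0 // ltW.
rewrite (le_trans (ler_norm_sum _ _ _)) // -(sum_dotp_eq R a z0).
apply: ler_sum => y _; rewrite normrM /disc.
case: eqP => _; rewrite ?normr0 ?mul0r // normr1 mul1r ler_norml.
by case: eqP => _ /=; lra.
Qed.

(** By [corr_indep] only multiples of x contribute. Stating an inequality spares the injectivity of
    c |-> c x. *)
Lemma sum_corr_line (R : realFieldType) (F : finFieldType) (d : nat) (a : F)
    (x : 'rV[F]_d) : x != 0 ->
  \sum_z `|corr R a x z| <= \sum_c `|corr R a x (c *: x)|.
Proof.
move=> x0.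
have -> : \sum_c `|corr R a x (c *: x)|
          = \sum_z \sum_c `|corr R a x z| * (z == c *: x)%:R.
  rewrite exchange_big; apply: eq_bigr => c _.
  rewrite (bigD1 (c *: x)) //= eqxx mulr1 big1 ?addr0 // => z /negPf ->.
  by rewrite mulr0.
apply: ler_sum => z _; rewrite -mulr_sumr.
have [/existsP[c zc]|/existsPn zx] := boolP [exists c, z == c *: x].
  by rewrite ler_peMr // (bigD1 c) //= zc lerDl sumr_ge0.
by rewrite corr_indep // normr0 mul0r.
Qed.

Lemma sum_corr0 (R : realFieldType) (F : finFieldType) (d : nat) (a : F) :
  \sum_z `|corr R a (0 : 'rV[F]_d) z|
    = #|F|%:R ^+ d * ((0 == a)%:R - #|F|%:R^-1) ^+ 2.
Proof.
rewrite (bigD1 0) //= big1 => [|z z0]; last by rewrite corr0l // normr0.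
by rewrite addr0 corr00 ger0_norm // mulr_ge0 ?sqr_ge0 // exprn_ge0.
Qed.

(** A nonzero x has q multiples, each contributing at most q^(d-1); for x = 0 only z = 0
    contributes. *)
Lemma sum_corr_le (R : realFieldType) (F : finFieldType) (d : nat) (a : F)
    (x : 'rV[F]_d) : \sum_z `|corr R a x z| <= #|F|%:R ^+ d.
Proof.
have q0 := card_field_gt0 R F; have q1 := card_field_ge1 R F.
have [->|x0] := eqVneq x 0.
  rewrite sum_corr0 ler_piMr ?exprn_ge0 ?ler0n //.
  have : 0 <= (#|F|%:R^-1 : R) <= 1 by rewrite invr_ge0 ltW //= invf_le1.
  by case: eqP => _ /=; nra.
rewrite (le_trans (sum_corr_line R a x0)) //.
apply: (@le_trans _ _ (\sum_(c : F) (#|F|%:R ^+ d / #|F|%:R))).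
  by apply: ler_sum => c _; exact: norm_corr_le.
by rewrite sumr_const -[_ / _ *+ _]mulr_natr divfK ?gt_eqF.
Qed.

(** The gain of a factor q comes from parallel equations with the same nonzero right side being
    incompatible unless equal. So c = 1 contributes at most q^(d-1), and every other c at most the
    constant q^(d-2). *)
Lemma sum_corr_le_neq0 (R : realFieldType) (F : finFieldType) (d : nat) (a : F)
    (x : 'rV[F]_d) : a != 0 ->
  \sum_z `|corr R a x z| <= 2 * (#|F|%:R ^+ d / #|F|%:R).
Proof.
have q0 := card_field_gt0 R F; have q1 := card_field_ge1 R F => a0.
have qd0 : 0 <= (#|F|%:R ^+ d / #|F|%:R : R).
  by rewrite divr_ge0 ?exprn_ge0 ?ler0n.
have qdd0 : 0 <= (#|F|%:R ^+ d / #|F|%:R / #|F|%:R : R) by rewrite divr_ge0 ?ler0n.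
have [->|x0] := eqVneq x 0.
  rewrite sum_corr0 eq_sym (negPf a0) sub0r sqrrN expr2 mulrA.
  have : 0 <= (#|F|%:R^-1 : R) <= 1 by rewrite invr_ge0 ltW //= invf_le1.
  by nra.
rewrite (le_trans (sum_corr_line R a x0)) //.
rewrite (bigD1 1) //= scale1r mulr_natl mulr2n lerD ?norm_corr_le //.
(* Readmitting c = 1 makes the total exactly q times q^(d-2). *)
apply: (@le_trans _ _ (\sum_(c : F) (#|F|%:R ^+ d / #|F|%:R / #|F|%:R))).
  rewrite [leRHS](bigD1 1) //= ler_wpDl //.
  apply: ler_sum => c c1; have [->|c0] := eqVneq c 0.
    by rewrite scale0r corrC corr0l // normr0.
  rewrite corrE2 ?scaler_eq0 ?negb_or ?c0 // big1 => [|y _].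
    by rewrite sub0r normrN ger0_norm.
  (* x . y = a and (c x) . y = a force c = 1 *)
  rewrite dotpZl -natrM mulnb; case: (dotp x y =P a) => //= ->.
  by rewrite -{2}[a]mul1r (inj_eq (mulIf a0)) (negPf c1).
by rewrite sumr_const -[_ / _ *+ _]mulr_natr divfK ?gt_eqF.
Qed.

(** Schur's test: the left side is the quadratic form of B^2 at f, and |f y f z| <= (f y ^ 2 + f z ^
    2) / 2 reduces it to row sums of |B^2|. *)
Lemma disc_schur (R : realFieldType) (F : finFieldType) (d : nat) (a : F)
    (L : R) (f : 'rV[F]_d -> R) :
    (forall x : 'rV[F]_d, \sum_z `|corr R a x z| <= L) ->
  \sum_x (\sum_y disc R a x y * f y) ^+ 2 <= L * \sum_y f y ^+ 2.
Proof.
move=> ML; have -> : \sum_x (\sum_y disc R a x y * f y) ^+ 2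
                   = \sum_y \sum_z f y * f z * corr R a y z.
  under eq_bigr do rewrite expr2 big_distrlr.
  rewrite exchange_big; apply: eq_bigr => y _.
  rewrite exchange_big; apply: eq_bigr => z _.
  rewrite mulr_sumr; apply: eq_bigr => x _.
  by rewrite /= (discC R a x y) (discC R a x z); ring.
pose g y z := `|corr R a y z| * f y ^+ 2 / 2.
apply: (@le_trans _ _ (\sum_y \sum_z (g y z + g z y))).
  apply: ler_sum => y _; apply: ler_sum => z _.
  rewrite /g (corrC R a z y); set m := corr R a y z.
  (* The square to expand is (f y - f z)^2 or (f y + f z)^2, according to the sign of m. *)
  have [m0|m0] := leP 0 m.
    have := mulr_ge0 m0 (sqr_ge0 (f y - f z)); rewrite ger0_norm //; lra.
  have := mulr_le0_ge0 (ltW m0) (sqr_ge0 (f y + f z)); rewrite ltr0_norm //; lra.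
under eq_bigr do rewrite big_split.
rewrite big_split /= [X in _ + X]exchange_big -mulr2n -mulr_natl mulr_sumr.
rewrite mulr_sumr; apply: ler_sum => y _.
rewrite /g -!mulr_suml mulrC divfK ?pnatr_eq0 //.
by rewrite ler_wpM2r ?sqr_ge0.
Qed.

(** * The Euclidean norm on functions *)

Definition l2norm (R : rcfType) (T : finType) (f : T -> R) : R :=
  Num.sqrt (\sum_x f x ^+ 2).

Lemma l2norm_ge0 (R : rcfType) (T : finType) (f : T -> R) : 0 <= l2norm f.
Proof. exact: sqrtr_ge0. Qed.

Lemma sum_sqr_ge0 (R : rcfType) (T : finType) (f : T -> R) :
  0 <= \sum_x f x ^+ 2.
Proof. by apply: sumr_ge0 => x _; exact: sqr_ge0. Qed.

Lemma sqr_l2norm (R : rcfType) (T : finType) (f : T -> R) :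
  l2norm f ^+ 2 = \sum_x f x ^+ 2.
Proof. by rewrite sqr_sqrtr // sum_sqr_ge0. Qed.

(** Lagrange's identity: the double sum of (f x g y - f y g x)^2 is twice the difference of the two
    squared sides. *)
Lemma cauchy_schwarz (R : rcfType) (T : finType) (f g : T -> R) :
  `|\sum_x f x * g x| <= l2norm f * l2norm g.
Proof.
rewrite -(@ler_pXn2r _ 2) ?nnegrE ?mulr_ge0 ?l2norm_ge0 //.
rewrite exprMn !sqr_l2norm real_normK ?num_real //.
have : 0 <= \sum_x \sum_y (f x * g y - f y * g x) ^+ 2.
  by apply: sumr_ge0 => x _; exact: sum_sqr_ge0.
have -> : \sum_x \sum_y (f x * g y - f y * g x) ^+ 2
        = \sum_x \sum_y (f x ^+ 2 * g y ^+ 2 + g x ^+ 2 * f y ^+ 2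
            - 2 * ((f x * g x) * (f y * g y))).
  by apply: eq_bigr => x _; apply: eq_bigr => y _; ring.
under eq_bigr do rewrite big_split big_split /= -!mulr_sumr sumrN -mulr_sumr.
rewrite big_split big_split /= sumrN -!mulr_suml -mulr_sumr -big_distrlr /=.
by rewrite expr2; lra.
Qed.

Lemma l2norm_triangle (R : rcfType) (T : finType) (f g : T -> R) :
  l2norm (fun x => f x + g x) <= l2norm f + l2norm g.
Proof.
rewrite -(@ler_pXn2r _ 2) ?nnegrE ?addr_ge0 ?l2norm_ge0 //.
rewrite sqr_l2norm.
have -> : \sum_x (f x + g x) ^+ 2
        = \sum_x f x ^+ 2 + \sum_x g x ^+ 2 + 2 * \sum_x f x * g x.
  rewrite mulr_sumr -!big_split; apply: eq_bigr => x _ /=; ring.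
rewrite -!sqr_l2norm.
have := le_trans (ler_norm _) (cauchy_schwarz f g); nra.
Qed.

Lemma l2normZ (R : rcfType) (T : finType) (c : R) (f : T -> R) :
  0 <= c -> l2norm (fun x => c * f x) = c * l2norm f.
Proof.
move=> c0; rewrite /l2norm; under eq_bigr do rewrite exprMn.
by rewrite -mulr_sumr sqrtrM ?sqr_ge0 // sqrtr_sqr ger0_norm.
Qed.

Lemma sum_ind (R : pzSemiRingType) (T : finType) (E : {set T}) :
  \sum_x (x \in E)%:R = #|E|%:R :> R.
Proof.
rewrite -sum1_card natr_sum [RHS]big_mkcond.
by apply: eq_bigr => x _; case: (x \in E).
Qed.

Lemma l2norm_ind (R : rcfType) (T : finType) (E : {set T}) :
  l2norm (fun x => (x \in E)%:R : R) = Num.sqrt #|E|%:R.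
Proof.
rewrite /l2norm -sum_ind; congr (Num.sqrt _).
by apply: eq_bigr => x _; case: (x \in E); rewrite ?expr1n ?expr0n.
Qed.

(** * Vectors close to a multiple of the indicator of E *)

Definition adj_step (R : rcfType) (F : finFieldType) (d : nat)
    (E : {set 'rV[F]_d}) (a : F) (f : 'rV[F]_d -> R) (x : 'rV[F]_d) : R :=
  (x \in E)%:R * \sum_y (dotp x y == a)%:R * f y.

(** The error is measured relative to the norm of c 1_E, so that each step acts on 1 + delta by a
    plain multiplication. *)
Definition near_ind (R : rcfType) (T : finType) (E : {set T})
    (c delta : R) (f : T -> R) : Prop :=
  l2norm (fun x => f x - c * (x \in E)%:R) <= delta * (c * Num.sqrt #|E|%:R).

Lemma near_ind_self (R : rcfType) (T : finType) (E : {set T}) :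
  near_ind E 1 0 (fun x => (x \in E)%:R : R).
Proof.
rewrite /near_ind mul0r /l2norm big1 ?sqrtr0 // => x _.
by rewrite mul1r subrr expr0n.
Qed.

(** The constant part 1/q keeps the relative error at delta, and B adds at most lam |f|, which is (1
    + delta) t relative to the new main term, with t = lam q / |E|. Finally delta + (1 + delta) t =
    (1 + delta)(1 + t) - 1. *)
Lemma adj_step_near_ind (R : rcfType) (F : finFieldType) (d : nat)
    (E : {set 'rV[F]_d}) (a : F) (c delta lam : R) (f : 'rV[F]_d -> R) :
    (0 < #|E|)%N -> 0 <= c -> 0 <= lam ->
    (forall x : 'rV[F]_d, \sum_z `|corr R a x z| <= lam ^+ 2) ->
    near_ind E c delta f -> (forall x, x \notin E -> f x = 0) ->
  near_ind E (c * (#|E|%:R / #|F|%:R))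
    ((1 + delta) * (1 + lam * #|F|%:R / #|E|%:R) - 1) (adj_step E a f).
Proof.
move=> E0 c0 lam0 lamP fP f0; set n : R := #|E|%:R; set q : R := #|F|%:R.
have q0 : 0 < q := card_field_gt0 R F.
have n0 : 0 < n by rewrite ltr0n.
have s0 : 0 < Num.sqrt n by rewrite sqrtr_gt0.
have sqn : Num.sqrt n * Num.sqrt n = n by rewrite -expr2 sqr_sqrtr // ltW.
pose ind x : R := (x \in E)%:R.
have indE : l2norm ind = Num.sqrt n := l2norm_ind R E.
have indK x : ind x * ind x = ind x.
  by rewrite /ind; case: (x \in E); rewrite ?mulr1 ?mulr0.
have fK x : f x * ind x = f x.
  by rewrite /ind; case: (boolP (x \in E)) => [|/f0 ->]; rewrite ?mulr1 ?mul0r.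
pose e x := f x - c * ind x.
have eP : l2norm e <= delta * (c * Num.sqrt n) := fP.
(* The constant part sees the error e only through its total mass s; as e is supported on E,
   Cauchy-Schwarz against 1_E bounds s. *)
pose s := \sum_x e x.
have sP : `|s| <= delta * (c * n).
  have -> : s = \sum_x e x * ind x.
    by apply: eq_bigr => x _; rewrite /e mulrBl fK -mulrA indK.
  have -> : delta * (c * n) = delta * (c * Num.sqrt n) * Num.sqrt n.
    by rewrite -!mulrA sqn.
  by rewrite (le_trans (cauchy_schwarz _ _)) // indE ler_pM2r.
have fE : \sum_x f x = c * n + s.
  rewrite /s /e big_split /= sumrN -mulr_sumr sum_ind.
  by rewrite addrCA subrr addr0.
have fN : l2norm f <= (1 + delta) * (c * Num.sqrt n).
  have -> : l2norm f = l2norm (fun x => c * ind x + e x).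
    congr (Num.sqrt _); apply: eq_bigr => x _.
    by rewrite /e addrCA subrr addr0.
  rewrite (le_trans (l2norm_triangle _ _)) // l2normZ // indE mulrDl mul1r.
  by rewrite lerD2l.
pose Bf x := \sum_y disc R a x y * f y.
have BfN : l2norm Bf <= lam * l2norm f.
  rewrite -(@ler_pXn2r _ 2) ?nnegrE ?mulr_ge0 ?l2norm_ge0 //.
  by rewrite exprMn !sqr_l2norm; exact: disc_schur.
(* Since f has sum c n + s, the constant part yields (c n + s) / q on E, and its main term
   cancels. *)
have adj_stepE x : adj_step E a f x - c * (n / q) * ind x
             = s / q * ind x + ind x * Bf x.
  rewrite /adj_step -/(ind x) /Bf /disc.
  under [in RHS]eq_bigr do rewrite mulrBl.
  rewrite big_split /= sumrN -mulr_sumr fE -/q.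
  by field; rewrite gt_eqF.
rewrite /near_ind.
have -> : l2norm (fun x => adj_step E a f x - c * (n / q) * ind x)
        = l2norm (fun x => s / q * ind x + ind x * Bf x).
  by congr (Num.sqrt _); apply: eq_bigr => x _; rewrite adj_stepE.
rewrite (le_trans (l2norm_triangle _ _)) //.
have t1 : l2norm (fun x => s / q * ind x) <= `|s| / q * Num.sqrt n.
  rewrite -indE -l2normZ; last by rewrite divr_ge0 // ltW.
  apply: ler_wsqrtr.
  by apply: ler_sum => x _; rewrite !exprMn real_normK ?num_real.
have t2 : l2norm (fun x => ind x * Bf x) <= l2norm Bf.
  apply: ler_wsqrtr; apply: ler_sum => x _.
  by rewrite /ind; case: (x \in E); rewrite ?mul1r ?mul0r ?expr0n ?sqr_ge0.
apply: (@le_trans _ _ (delta * (c * n) / q * Num.sqrt n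
                       + lam * ((1 + delta) * (c * Num.sqrt n)))).
  apply: lerD; last first.
    by rewrite (le_trans t2) // (le_trans BfN) // ler_wpM2l.
  by rewrite (le_trans t1) // ler_pM2r // ler_pM2r ?invr_gt0.
rewrite le_eqVlt; apply/orP; left; apply/eqP.
by field; rewrite !gt_eqF.
Qed.

Lemma near_ind_sum (R : rcfType) (T : finType) (E : {set T})
    (c delta : R) (f : T -> R) :
    near_ind E c delta f -> (forall x, x \notin E -> f x = 0) ->
  `|\sum_x f x - c * #|E|%:R| <= delta * (c * #|E|%:R).
Proof.
move=> fP f0.
have sqn : Num.sqrt #|E|%:R * Num.sqrt #|E|%:R = #|E|%:R :> R.
  by rewrite -expr2 sqr_sqrtr.
have -> : \sum_x f x - c * #|E|%:R
        = \sum_x (f x - c * (x \in E)%:R) * (x \in E)%:R.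
  rewrite -sum_ind mulr_sumr -sumrN -big_split /=.
  apply: eq_bigr => x _; case: (boolP (x \in E)) => [_|/f0 ->].
    by rewrite !mulr1.
  by rewrite !mulr0 subrr.
rewrite (le_trans (cauchy_schwarz _ _)) // l2norm_ind.
have -> : delta * (c * #|E|%:R)
        = delta * (c * Num.sqrt #|E|%:R) * Num.sqrt #|E|%:R.
  by rewrite -!mulrA sqn.
by rewrite ler_wpM2r ?sqrtr_ge0.
Qed.

Lemma adj_step_out (R : rcfType) (F : finFieldType) (d : nat)
    (E : {set 'rV[F]_d}) (a : F) (f : 'rV[F]_d -> R) x :
  x \notin E -> adj_step E a f x = 0.
Proof. by rewrite /adj_step => /negPf ->; rewrite mul0r. Qed.

Lemma ind_out (R : pzSemiRingType) (T : finType) (E : {set T}) x :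
  x \notin E -> (x \in E)%:R = 0 :> R.
Proof. by move/negPf ->. Qed.

(** * Counting walks of length 2 and 3 in E *)

Definition walk2 (F : finFieldType) (d : nat) (E : {set 'rV[F]_d})
    (a b : F) (x y z : 'rV[F]_d) : bool :=
  [&& x \in E, y \in E, z \in E, dotp x y == a & dotp y z == b].

Definition walk3 (F : finFieldType) (d : nat) (E : {set 'rV[F]_d})
    (a b c : F) (x y z w : 'rV[F]_d) : bool :=
  [&& x \in E, dotp x y == a & walk2 E b c y z w].

Lemma walk2_adj_step (R : rcfType) (F : finFieldType) (d : nat)
    (E : {set 'rV[F]_d}) (a b : F) (x : 'rV[F]_d) :
  \sum_y \sum_z (walk2 E a b x y z)%:R
    = adj_step E a (adj_step E b (fun x => (x \in E)%:R)) x :> R.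
Proof.
rewrite /adj_step mulr_sumr; apply: eq_bigr => y _.
rewrite !mulr_sumr; apply: eq_bigr => z _; rewrite /walk2.
rewrite -!natrM !mulnb; congr (nat_of_bool _)%:R.
case: (x \in E); case: (y \in E); case: (z \in E) => //=;
  by rewrite ?andbF ?andbT.
Qed.

Lemma walk3_adj_step (R : rcfType) (F : finFieldType) (d : nat)
    (E : {set 'rV[F]_d}) (a b c : F) (x : 'rV[F]_d) :
  \sum_y \sum_z \sum_w (walk3 E a b c x y z w)%:R
    = adj_step E a (adj_step E b (adj_step E c (fun x => (x \in E)%:R))) x :> R.
Proof.
rewrite [RHS]/adj_step mulr_sumr; apply: eq_bigr => y _.
rewrite -walk2_adj_step !mulr_sumr; apply: eq_bigr => z _.
rewrite !mulr_sumr; apply: eq_bigr => w _; rewrite /walk3.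
by case: (x \in E); case: (dotp x y == a); rewrite ?(mul0r, mul1r).
Qed.

(** Start from 1_E with c = 1 and delta = 0; the steps are applied from the last edge of the walk
    back to the first. *)
Lemma sum_walk2 (R : rcfType) (F : finFieldType) (d : nat)
    (E : {set 'rV[F]_d}) (a b : F) (lam : R) :
    (0 < #|E|)%N -> 0 <= lam ->
    (forall c, c \in [:: a; b] ->
      forall x : 'rV[F]_d, \sum_z `|corr R c x z| <= lam ^+ 2) ->
  `|\sum_x \sum_y \sum_z (walk2 E a b x y z)%:R
    - #|E|%:R ^+ 3 / #|F|%:R ^+ 2|
    <= ((1 + lam * #|F|%:R / #|E|%:R) ^+ 2 - 1) * (#|E|%:R ^+ 3 / #|F|%:R ^+ 2).
Proof.
move=> E0 lam0 lamP; set m : R := #|E|%:R ^+ 3 / _.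
set t := lam * _ / _; under eq_bigr do rewrite walk2_adj_step.
have n0 : 0 < #|E|%:R :> R by rewrite ltr0n.
have q0 := card_field_gt0 R F.
have nq0 : 0 <= #|E|%:R / #|F|%:R :> R by rewrite divr_ge0 ?ler0n.
have bP := lamP b; have aP := lamP a; rewrite !inE !eqxx ?orbT in aP bP.
have f1 := adj_step_near_ind E0 ler01 lam0 (bP isT) (near_ind_self R E)
  (@ind_out R _ E).
have f2 := adj_step_near_ind E0 (mulr_ge0 ler01 nq0) lam0 (aP isT) f1
  (@adj_step_out _ _ _ _ _ _).
have := near_ind_sum f2 (@adj_step_out _ _ _ _ _ _); rewrite -/t.
have -> : 1 * (#|E|%:R / #|F|%:R) * (#|E|%:R / #|F|%:R) * #|E|%:R = m.
  by rewrite /m; field; rewrite gt_eqF.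
by congr (_ <= _ * _); ring.
Qed.

Lemma sum_walk3 (R : rcfType) (F : finFieldType) (d : nat)
    (E : {set 'rV[F]_d}) (a b c : F) (lam : R) :
    (0 < #|E|)%N -> 0 <= lam ->
    (forall e, e \in [:: a; b; c] ->
      forall x : 'rV[F]_d, \sum_z `|corr R e x z| <= lam ^+ 2) ->
  `|\sum_x \sum_y \sum_z \sum_w (walk3 E a b c x y z w)%:R
    - #|E|%:R ^+ 4 / #|F|%:R ^+ 3|
    <= ((1 + lam * #|F|%:R / #|E|%:R) ^+ 3 - 1) * (#|E|%:R ^+ 4 / #|F|%:R ^+ 3).
Proof.
move=> E0 lam0 lamP; set m : R := #|E|%:R ^+ 4 / _.
set t := lam * _ / _; under eq_bigr do rewrite walk3_adj_step.
have n0 : 0 < #|E|%:R :> R by rewrite ltr0n.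
have q0 := card_field_gt0 R F.
have nq0 : 0 <= #|E|%:R / #|F|%:R :> R by rewrite divr_ge0 ?ler0n.
have cP := lamP c; have bP := lamP b; have aP := lamP a.
rewrite !inE !eqxx ?orbT in aP bP cP.
have f1 := adj_step_near_ind E0 ler01 lam0 (cP isT) (near_ind_self R E)
  (@ind_out R _ E).
have f2 := adj_step_near_ind E0 (mulr_ge0 ler01 nq0) lam0 (bP isT) f1
  (@adj_step_out _ _ _ _ _ _).
have f3 := adj_step_near_ind E0 (mulr_ge0 (mulr_ge0 ler01 nq0) nq0) lam0
  (aP isT) f2 (@adj_step_out _ _ _ _ _ _).
have := near_ind_sum f3 (@adj_step_out _ _ _ _ _ _); rewrite -/t.
have -> : 1 * (#|E|%:R / #|F|%:R) * (#|E|%:R / #|F|%:R)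
          * (#|E|%:R / #|F|%:R) * #|E|%:R = m.
  by rewrite /m; field; rewrite gt_eqF.
by congr (_ <= _ * _); ring.
Qed.

(** * Chains as 3-walks with distinct points *)

Lemma sum_tupleS (V : nmodType) (T : finType) (n : nat)
    (g : n.+1.-tuple T -> V) :
  \sum_t g t = \sum_x \sum_(t : n.-tuple T) g [tuple of x :: t].
Proof.
rewrite pair_big (reindex (fun p : T * n.-tuple T => [tuple of p.1 :: p.2])) //.
exists (fun t : n.+1.-tuple T => (thead t, [tuple of behead t])) => [[x t] _|t _].
  by congr (_, _); apply/val_inj.
by rewrite /= -tuple_eta.
Qed.

Lemma sum_tuple4 (V : nmodType) (T : finType) (g : 4.-tuple T -> V) :
  \sum_t g t = \sum_x \sum_y \sum_z \sum_w g [tuple x; y; z; w].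
Proof.
rewrite sum_tupleS; apply: eq_bigr => x _.
rewrite sum_tupleS; apply: eq_bigr => y _.
rewrite sum_tupleS; apply: eq_bigr => z _.
rewrite sum_tupleS; apply: eq_bigr => w _.
rewrite (big_pred1 [tuple]) => [|t]; last by apply/esym/eqP; exact: (tuple0 t).
by congr g; apply/val_inj.
Qed.

Lemma dot_chains_inE (F : finFieldType) (d : nat) (alpha : 3.-tuple F)
    (E : {set 'rV[F]_d}) x y z w :
  ([tuple x; y; z; w] \in dot_chains_in alpha E)
  = uniq [:: x; y; z; w] && walk3 E alpha`_0 alpha`_1 alpha`_2 x y z w.
Proof.
rewrite inE /dot_chain -andbA; congr (_ && _); apply/andP/idP.
  case=> /forallP P /forallP Q.
  pose o3 k (h : (k < 3)%N) := P (Ordinal h).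
  pose o4 k (h : (k < 4)%N) := Q (Ordinal h).
  move: (o3 0 isT) (o3 1 isT) (o3 2 isT).
  move: (o4 0 isT) (o4 1 isT) (o4 2 isT) (o4 3 isT).
  rewrite !(tnth_nth 0) /= /walk3 /walk2.
  by move=> -> -> -> -> -> -> ->.
case/and3P => xE xy /and5P[yE zE wE yz zw].
by split; apply/forallP => -[[|[|[|[|//]]]] h]; rewrite !(tnth_nth 0) /=.
Qed.

Lemma card_dot_chains_in (R : rcfType) (F : finFieldType) (d : nat)
    (alpha : 3.-tuple F) (E : {set 'rV[F]_d}) :
  #|dot_chains_in alpha E|%:R = \sum_x \sum_y \sum_z \sum_w
    (uniq [:: x; y; z; w] && walk3 E alpha`_0 alpha`_1 alpha`_2 x y z w)%:R :> R.
Proof.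
rewrite -sum_ind sum_tuple4.
do 4! (apply: eq_bigr => ? _); by rewrite dot_chains_inE.
Qed.

(** * Degenerate walks and the resulting estimate *)

Lemma sum_delta (R : pzSemiRingType) (T : finType) (x : T) (h : T -> R) :
  \sum_y (x == y)%:R * h y = h x.
Proof.
rewrite (bigD1 x) //= eqxx mul1r big1 ?addr0 // => y.
by rewrite eq_sym => /negPf ->; rewrite mul0r.
Qed.

(** A union bound over the six coincidences. If an endpoint equals another point, deleting that
    endpoint leaves a 2-walk; if y = z, merging the two leaves a walk with edge values a and c. *)
Lemma walk3_le (R : realFieldType) (F : finFieldType) (d : nat)
    (E : {set 'rV[F]_d}) (a b c : F) (x y z w : 'rV[F]_d) :
  (walk3 E a b c x y z w)%:R <= (uniq [:: x; y; z; w] && walk3 E a b c x y z w)%:R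
    + (x == y)%:R * (walk2 E b c y z w)%:R
    + (x == z)%:R * (walk2 E b c y z w)%:R
    + (x == w)%:R * (walk2 E a b x y z)%:R
    + (y == w)%:R * (walk2 E a b x y z)%:R
    + (z == w)%:R * (walk2 E a b x y z)%:R
    + (y == z)%:R * (walk2 E a c x y w)%:R :> R.
Proof.
rewrite -!natrM -!natrD ler_nat !mulnb /= !inE !negb_or.
case: (boolP (walk3 E a b c x y z w)) => // W; rewrite andbT.
have Wab : walk2 E a b x y z.
  by case/and3P: W => xE xy /and5P[yE zE wE yz zw]; apply/and5P.
have Wbc : walk2 E b c y z w by case/and3P: W.
have Wac : y == z -> walk2 E a c x y w.
  move/eqP=> yz; subst z.
  by case/and3P: W => xE xy /and5P[yE zE wE _ zw]; apply/and5P.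
rewrite Wab Wbc.
case: (x == y); case: (x == z); case: (x == w); case: (y == w);
  case: (z == w); case: (boolP (y == z)) Wac => //= _ ->; by [].
Qed.

Lemma sum_walk3_le (R : realFieldType) (F : finFieldType) (d : nat)
    (E : {set 'rV[F]_d}) (a b c : F) :
  let W2 e f := \sum_x \sum_y \sum_z (walk2 E e f x y z)%:R in
  \sum_x \sum_y \sum_z \sum_w (walk3 E a b c x y z w)%:R
    <= \sum_x \sum_y \sum_z \sum_w
         (uniq [:: x; y; z; w] && walk3 E a b c x y z w)%:R
       + (3 * W2 a b + 2 * W2 b c + W2 a c) :> R.
Proof.
cbv zeta.
apply: (@le_trans _ _ _ _ _ (ler_sum _ (fun x _ => ler_sum _ (fun y _ =>
  ler_sum _ (fun z _ => ler_sum _ (fun w _ => walk3_le R E a b c x y z w)))))).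
rewrite le_eqVlt; apply/orP; left; apply/eqP.
under eq_bigr do under eq_bigr do under eq_bigr do
  rewrite !big_split /= !sum_delta -!mulr_sumr.
under eq_bigr do under eq_bigr do rewrite !big_split /= !sum_delta -!mulr_sumr.
under eq_bigr do rewrite !big_split /= !sum_delta.
rewrite !big_split /=.
(* The coincidence x = z leaves the first two points summed in the opposite order. *)
have -> : \sum_x \sum_y \sum_w (walk2 E b c y x w)%:R
  = \sum_x \sum_y \sum_z (walk2 E b c x y z)%:R :> R by rewrite exchange_big.
ring.
Qed.

(** Chains number at most the 3-walks, and at least the 3-walks minus six families of 2-walks, which
    account for the term 6 t (1 + t)^2. *)
Lemma dot_chains_estimate (R : rcfType) (F : finFieldType) (d : nat)
    (E : {set 'rV[F]_d}) (alpha : 3.-tuple F) (lam t : R) :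
    (0 < #|E|)%N -> 1 <= lam -> lam * #|F|%:R / #|E|%:R <= t ->
    (forall j (x : 'rV[F]_d),
       \sum_z `|corr R (tnth alpha j) x z| <= lam ^+ 2) ->
  `|#|dot_chains_in alpha E|%:R - #|E|%:R ^+ 4 / #|F|%:R ^+ 3|
    <= ((1 + t) ^+ 3 - 1 + 6 * t * (1 + t) ^+ 2)
       * (#|E|%:R ^+ 4 / #|F|%:R ^+ 3).
Proof.
move=> E0 lam1 lamt lamP.
have lam0 : 0 <= lam by rewrite (le_trans _ lam1).
have n0 : 0 < #|E|%:R :> R by rewrite ltr0n.
have q0 := card_field_gt0 R F.
have {}lamP e : e \in [:: alpha`_0; alpha`_1; alpha`_2] ->
    forall x : 'rV[F]_d, \sum_z `|corr R e x z| <= lam ^+ 2.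
  rewrite !inE => /or3P[] /eqP -> x.
  - by have := lamP (Ordinal (isT : (0 < 3)%N)) x; rewrite (tnth_nth 0).
  - by have := lamP (Ordinal (isT : (1 < 3)%N)) x; rewrite (tnth_nth 0).
  - by have := lamP (Ordinal (isT : (2 < 3)%N)) x; rewrite (tnth_nth 0).
have W3 := sum_walk3 E0 lam0 lamP.
set S := \sum_x _ in W3.
pose W2 e f : R := \sum_x \sum_y \sum_z (walk2 E e f x y z)%:R.
set n : R := #|E|%:R; set q : R := #|F|%:R; set m := n ^+ 4 / q ^+ 3.
set u := lam * q / n in lamt W3.
have m0 : 0 <= m by rewrite divr_ge0 ?exprn_ge0 // ler0n.
have u0 : 0 <= u by rewrite divr_ge0 ?mulr_ge0 ?ler0n.
have t0 := le_trans u0 lamt.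
have W2P e f : e \in [:: alpha`_0; alpha`_1; alpha`_2] ->
    f \in [:: alpha`_0; alpha`_1; alpha`_2] -> W2 e f <= t * (1 + t) ^+ 2 * m.
  move=> eP fP; have := @sum_walk2 R F d E e f lam E0 lam0.
  have efP c : c \in [:: e; f] ->
      forall x : 'rV[F]_d, \sum_z `|corr R c x z| <= lam ^+ 2.
    by rewrite !inE => /orP[] /eqP ->; apply: lamP.
  move=> /(_ efP) /(le_trans (ler_norm _)); rewrite -/(W2 e f) -/n -/q -/u.
  have -> : n ^+ 3 / q ^+ 2 = q / n * m by rewrite /m; field; rewrite !gt_eqF.
  (* Here 1 <= lam enters: the loss q / n from dropping a point is absorbed into t. *)
  have qnu : q / n <= u.
    by rewrite /u ler_pM2r ?invr_gt0 // ler_peMl // ltW.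
  move=> W2u.
  have {}W2u : W2 e f <= (1 + u) ^+ 2 * (q / n * m) by lra.
  apply: (le_trans W2u); rewrite mulrA ler_wpM2r //.
  rewrite mulrC ler_pM //; first by rewrite divr_ge0 ?ler0n.
  - by rewrite exprn_ge0 // addr_ge0.
  - exact: le_trans qnu lamt.
  - by rewrite lerXn2r ?nnegrE ?addr_ge0 // lerD2l.
have := W2P alpha`_0 alpha`_1; have := W2P alpha`_1 alpha`_2.
have := W2P alpha`_0 alpha`_2; rewrite !inE !eqxx ?orbT.
move=> /(_ isT isT) W02 /(_ isT isT) W12 /(_ isT isT) W01.
have ut3 : ((1 + u) ^+ 3 - 1) * m <= ((1 + t) ^+ 3 - 1) * m.
  rewrite ler_wpM2r // lerD2r lerXn2r ?nnegrE ?addr_ge0 //.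
  by rewrite lerD2l.
have W3le : S <= #|dot_chains_in alpha E|%:R + (3 * W2 alpha`_0 alpha`_1
    + 2 * W2 alpha`_1 alpha`_2 + W2 alpha`_0 alpha`_2).
  by rewrite card_dot_chains_in; exact: sum_walk3_le.
have Nle : #|dot_chains_in alpha E|%:R <= S.
  rewrite card_dot_chains_in; do 4! (apply: ler_sum => ? _).
  by rewrite ler_nat; case: (uniq _).
have tm0 : 0 <= t * (1 + t) ^+ 2 * m.
  by rewrite mulr_ge0 // mulr_ge0 // exprn_ge0 // addr_ge0.
move: W3; rewrite -/n -/q -/m !ler_norml => /andP[W3a W3b].
by apply/andP; split; lra.
Qed.

(** * Asymptotics in q and the final choice of parameters *)

Lemma cvg_powRN0 (R : realType) (e : R) : 0 < e ->
  (q%:R `^ e)^-1 @[q --> \oo] --> (0 : R).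
Proof.
(* The shift makes the base 1/(n+1) well defined and positive, as the one-sided limit of the power
   function at 0 requires. *)
move=> e0; rewrite -cvg_shiftS.
have : (n.+1%:R^-1 : R) `^ e @[n --> \oo] --> (0 : R).
  move/cvg_at_rightP: (powR_cvg0 e0); apply; split.
    by move=> n; rewrite invr_gt0.
  exact: cvg_harmonic.
apply: cvg_trans; apply: near_eq_cvg; near=> n.
by rewrite -powR_inv1 // -powRrM mulN1r powRN.
Unshelve. all: by end_near. Qed.

(** This is the error factor of [dot_chains_estimate] at t = (2 / C) q^-e; it serves as [eta] in the
    theorem. *)
Lemma cvg_error_bound (R : realType) (C e : R) : 0 < e ->
  (1 + 2 / C * (q%:R `^ e)^-1) ^+ 3 - 1
    + 6 * (2 / C * (q%:R `^ e)^-1) * (1 + 2 / C * (q%:R `^ e)^-1) ^+ 2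
  @[q --> \oo] --> (0 : R).
Proof.
move=> e0; pose t q : R := 2 / C * (q%:R `^ e)^-1.
have t0 : t q @[q --> \oo] --> (0 : R).
  by rewrite -(mulr0 (2 / C)); apply: cvgMr; exact: cvg_powRN0.
have t1 : 1 + t q @[q --> \oo] --> (1 : R).
  by rewrite -[X in _ --> X]addr0; apply: cvgD t0; exact: cvg_cst.
have -> : (0 : R) = 1 * (1 * 1) - 1 + 6 * 0 * (1 * 1).
  by rewrite !mulr1 subrr !mulr0 addr0.
apply: cvgD.
  by apply: cvgB; [do 2 ?apply: cvgM | exact: cvg_cst].
by do 2 ?apply: cvgM => //; exact: cvg_cst.
Qed.

(** Used with lam = k q^s, for (k, s) = (1, d/2) and (2, (d-1)/2); the bound 2 on k gives both cases
    the same error. *)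
Lemma error_ratio_le (R : realType) (C eps s k q n : R) :
    0 < C -> 1 <= q -> 0 <= k <= 2 ->
    C * q `^ eps * q `^ (s + 1) <= n ->
  k * q `^ s * q / n <= 2 / C * (q `^ eps)^-1.
Proof.
move=> C0 q1 /andP[k0 k2] nP.
have q0 : 0 < q by rewrite (lt_le_trans _ q1).
have qe := powR_gt0 eps q0; have qs := powR_gt0 s q0.
have n0 : 0 < n by rewrite (lt_le_trans _ nP) // !mulr_gt0 ?powR_gt0.
move: nP; rewrite powRD; last by rewrite (gt_eqF q0) implybT.
rewrite powRr1 ?(ltW q0) // => nP.
rewrite ler_pdivrMr //; apply: (@le_trans _ _ (2 * (q `^ s * q))).
  by rewrite -mulrA ler_wpM2r // mulr_ge0 ?ltW.
have -> : 2 * (q `^ s * q)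
        = 2 / C * (q `^ eps)^-1 * (C * q `^ eps * (q `^ s * q)).
  by field; rewrite !gt_eqF.
by rewrite ler_wpM2l // mulr_ge0 ?divr_ge0 ?invr_ge0 ?ltW.
Qed.

Theorem theorem1p2 (R : realType) (d : nat) (eps C : R)
    (hd : (1 <= d)%N) (heps : 0 < eps) (hC : 0 < C) :
  exists eta : nat -> R,
    eta @ \oo --> (0 : R) /\
    forall (q : nat) (F : finFieldType) (E : {set 'rV[F]_d})
           (alpha : 3.-tuple F),
      odd_prime_power q -> #|F| = q ->
      [\/ C * q%:R `^ eps * q%:R `^ ((d%:R + 3) / 2) <= #|E|%:R,
          (exists j, tnth alpha j != 0) /\
          C * q%:R `^ eps * q%:R `^ ((d%:R + 2) / 2) <= #|E|%:R
        | (forall j, tnth alpha j != 0) /\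
          C * q%:R `^ eps * q%:R `^ ((d%:R + 1) / 2) <= #|E|%:R] ->
      exists2 r : R, `|r| <= eta q &
        #|dot_chains_in alpha E|%:R
          = (1 + r) * (#|E|%:R ^+ 4 / q%:R ^+ 3).
Proof.
eexists; split; first exact: (cvg_error_bound C heps).
move=> _ F E alpha _ <- H.
have q1 := card_field_ge1 R F; have q0 := card_field_gt0 R F.
set q : R := #|F|%:R in q0 q1 *; set n : R := #|E|%:R.
have d1 : 1 <= d%:R :> R by rewrite ler1n.
suff [lam [lam1 lamt lamP]] : exists lam : R,
    [/\ 1 <= lam, lam * q / n <= 2 / C * (q `^ eps)^-1 &
      forall j (x : 'rV[F]_d),
        \sum_z `|corr R (tnth alpha j) x z| <= lam ^+ 2].
  have n0 : 0 < n.
    by case: H => [|[_]|[_]]; apply: lt_le_trans; rewrite !mulr_gt0 ?powR_gt0.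
  have m0 : 0 < n ^+ 4 / q ^+ 3 by rewrite divr_gt0 ?exprn_gt0.
  have E0 : (0 < #|E|)%N by rewrite -(ltr0n R).
  have := dot_chains_estimate E0 lam1 lamt lamP; rewrite -/n -/q => N.
  exists (#|dot_chains_in alpha E|%:R / (n ^+ 4 / q ^+ 3) - 1).
    rewrite -(ler_pM2r m0) -[X in _ * X <= _]gtr0_norm // -normrM.
    by rewrite mulrBl mul1r divfK ?gt_eqF.
  by rewrite addrC subrK divfK ?gt_eqF.
(* The thresholds are rewritten with exponent s + 1, where q^s is the size of the bound on |B|; in
   case (i) the exponent is lowered, as q >= 1. *)
have [nP|[aP nP]] : C * q `^ eps * q `^ (d%:R / 2 + 1) <= n
    \/ (forall j, tnth alpha j != 0) /\
       C * q `^ eps * q `^ ((d%:R - 1) / 2 + 1) <= n.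
- case: H => [nP|[_ nP]|[aP nP]].
  + left; apply: le_trans nP; rewrite ler_wpM2l ?mulr_ge0 ?powR_ge0 ?(ltW hC) //.
    by apply: ler_powR => //; lra.
  + by left; have -> : d%:R / 2 + 1 = (d%:R + 2) / 2 :> R by field.
  + by right; have -> : (d%:R - 1) / 2 + 1 = (d%:R + 1) / 2 :> R by field.
- exists (1 * q `^ (d%:R / 2)); split.
  + by rewrite mul1r -[leLHS](powRr0 q) ler_powR // divr_ge0.
  + by apply: error_ratio_le => //; lra.
  + move=> j x; rewrite mul1r -powR_mulrn ?powR_ge0 // -powRrM.
    by rewrite divfK ?pnatr_eq0 // powR_mulrn ?(ltW q0) // sum_corr_le.
(* The factor 2 exceeds the square root of 2 needed for |B|^2 <= 2 q^(d-1), and d >= 1 gives 1 <=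
   lam. *)
- exists (2 * q `^ ((d%:R - 1) / 2)); split.
  + have : 1 <= q `^ ((d%:R - 1) / 2).
      by rewrite -[leLHS](powRr0 q) ler_powR //; lra.
    by lra.
  + by apply: error_ratio_le => //; lra.
  + move=> j x; rewrite exprMn -[_ `^ _ ^+ 2]powR_mulrn ?powR_ge0 // -powRrM.
    rewrite divfK ?pnatr_eq0 // powRB ?(gt_eqF q0) ?implybT //.
    rewrite powR_mulrn ?(ltW q0) // powRr1 ?(ltW q0) //.
    rewrite (le_trans (sum_corr_le_neq0 R x (aP j))) //.
    by rewrite ler_wpM2r ?divr_ge0 ?exprn_ge0 ?(ltW q0) //; lra.
Qed.
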